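(* For every valid lattice $L\subset\mathbb{Z}^2$, the set $\mathscr{F}(L)$ of all flux values of domino tilings of the torus $\mathbb{T}_L=\mathbb{R}^2/L$ is $$\mathscr{F}(L)=L^{\#}\cap Q,\qquad Q=\{(x,y)\in\mathbb{R}^2:\ |x|+|y|\le \tfrac12\}.$$
   Context: Coloring and tilings: the unit square $[i,i+1]\times[j,j+1]$ ($i,j\in\mathbb{Z}$) is black if $i+j$ is even and white otherwise. A domino is the union of two unit squares sharing a side. A tiling of $\mathbb{Z}^2$ is a set of dominoes with pairwise disjoint interiors covering $\mathbb{R}^2$. Valid lattices: let $\mathscr{E}=2\mathbb{Z}^2$ and $\mathscr{O}=2\mathbb{Z}^2+(1,1)$. A valid lattice is a subgroup $L\subset\mathbb{Z}^2$ generated by two linearly independent vectors $v_0,v_1\in\mathscr{E}\sqcup\mathscr{O}$. A tiling of $\mathbb{T}_L=\mathbb{R}^2/L$ is identified with an $L$-periodic tiling of $\mathbb{Z}^2$. Height functions: each unit edge between neighboring points of $\mathbb{Z}^2$ is oriented so that the boundary of every black square is oriented clockwise (hence the boundary of every white square counterclockwise). The height function $h_t:\mathbb{Z}^2\to\mathbb{Z}$ of a tiling $t$ is the unique function with $h_t(0)=0$ such that for every edge oriented from $u$ to $w$: $h_t(w)=h_t(u)+1$ if the edge does not cross a domino of $t$ (i.e. is not the common side of the two squares of a domino of $t$), and $h_t(w)=h_t(u)-3$ otherwise. Flux: for a tiling $t$ of $\mathbb{T}_L$, $h_t(u+v)-h_t(u)$ depends only on $v\in L$ (not on $u\in\mathbb{Z}^2$)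 and is additive in $v$; the flux of $t$ is the unique $\varphi_t\in\mathbb{R}^2$ with $4\langle\varphi_t,v\rangle=h_t(u+v)-h_t(u)$ for all $v\in L$, $u\in\mathbb{Z}^2$. $\mathscr{F}(L)=\{\varphi_t: t \text{ a tiling of }\mathbb{T}_L\}$. $L^{\#}$: with $L$ generated by two linearly independent vectors $v_0,v_1\in\mathscr{E}\sqcup\mathscr{O}$, $L^{\#}$ is the set of $\varphi\in\mathbb{R}^2$ such that for each $i\in\{0,1\}$: $\langle\varphi,v_i\rangle\in\mathbb{Z}$ if $v_i\in\mathscr{E}$ and $\langle\varphi,v_i\rangle\in\mathbb{Z}+\frac12$ if $v_i\in\mathscr{O}$ (this does not depend on the choice of basis). *)

(* Defs.v *)
From mathcomp Require Import all_boot all_order all_algebra.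
From mathcomp Require Import all_classical all_reals all_analysis.
Import numFieldNormedType.Exports.
Import Order.TTheory GRing.Theory Num.Theory.

Set Implicit Arguments.
Unset Strict Implicit.
Unset Printing Implicit Defensive.

Local Open Scope classical_set_scope.
Local Open Scope ring_scope.

(* A point [s] of Z^2 also names the unit square whose lower-left corner is
   [s], i.e. [s.1, s.1 + 1] x [s.2, s.2 + 1]. *)
Notation Z2 := (int * int)%type.

Definition black (s : Z2) : Prop := (2 %| s.1 + s.2)%Z.

(* The four sides of the square [s], directed clockwise. *)
Definition clockwise_sides (s : Z2) : seq (Z2 * Z2) :=
  let nw : Z2 := s + (0, 1) in
  let ne : Z2 := s + (1, 1) in
  let se : Z2 := s + (1, 0) in
  [:: (s, nw); (nw, ne); (ne, se); (se, s)].

Definition side (s u w : Z2) : Prop :=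
  (u, w) \in clockwise_sides s \/ (w, u) \in clockwise_sides s.

Definition common_side (s s' u w : Z2) : Prop :=
  [/\ s <> s', side s u w & side s' u w].

(* Every unit edge is a side of exactly one black square and one white square,
   so this orients each edge exactly once, and white squares get a
   counterclockwise boundary. *)
Definition oriented (u w : Z2) : Prop :=
  exists2 s, black s & (u, w) \in clockwise_sides s.

Definition lattice (v0 v1 : Z2) : set Z2 :=
  [set v | exists a b : int, v = v0 *~ a + v1 *~ b].

Definition lin_indep (v0 v1 : Z2) : Prop :=
  forall a b : int, v0 *~ a + v1 *~ b = 0 -> a = 0 /\ b = 0.

Definition scrE : set Z2 := [set v | exists w : Z2, v = w *+ 2].
Definition scrO : set Z2 := [set v | exists w : Z2, v = w *+ 2 + (1, 1)].

Definition valid_basis (v0 v1 : Z2) : Prop :=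
  [/\ (scrE `|` scrO) v0, (scrE `|` scrO) v1 & lin_indep v0 v1].

Section Plane.
Variable R : realType.

Notation plane := (R * R)%type.

Definition emb (v : Z2) : plane := (v.1%:~R, v.2%:~R).

Definition square (s : Z2) : set plane :=
  [set p | (s.1%:~R <= p.1 <= (s.1 + 1)%:~R) /\
           (s.2%:~R <= p.2 <= (s.2 + 1)%:~R)].

Definition domino (D : set plane) : Prop :=
  exists s s' u w, common_side s s' u w /\ D = square s `|` square s'.

Definition tiling (t : set (set plane)) : Prop :=
  [/\ t `<=` domino,
      trivIset t (fun D => interior D) &
      \bigcup_(D in t) D = setT].

Definition lattice_periodic (L : set Z2) (t : set (set plane)) : Prop :=
  forall v, L v -> forall D, t D -> t [set p + emb v | p in D].

Definition crosses (t : set (set plane)) (u w : Z2) : Prop :=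
  exists s s', common_side s s' u w /\ t (square s `|` square s').

Definition is_height (t : set (set plane)) (h : Z2 -> int) : Prop :=
  h 0 = 0 /\
  forall u w, oriented u w ->
    (~ crosses t u w -> h w = h u + 1) /\ (crosses t u w -> h w = h u - 3).

Definition dot (phi : plane) (v : Z2) : R :=
  phi.1 * v.1%:~R + phi.2 * v.2%:~R.

Definition is_flux (L : set Z2) (h : Z2 -> int) (phi : plane) : Prop :=
  forall v, L v -> forall u : Z2, 4 * dot phi v = (h (u + v) - h u)%:~R.

(* A tiling has exactly one height function; when it is [L]-periodic and [L] is
   a valid lattice it has exactly one flux, so quantifying over [h] makes no
   choice. *)
Definition flux_set (L : set Z2) : set plane :=
  [set phi | exists t h,
     [/\ tiling t, lattice_periodic L t, is_height t h & is_flux L h phi]].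

Definition sharp_cond (phi : plane) (v : Z2) : Prop :=
  (scrE v -> dot phi v \is a Num.int) /\
  (scrO v -> dot phi v - 2^-1 \is a Num.int).

(* L^# for L = [lattice v0 v1]; the set does not depend on the basis. *)
Definition sharp (v0 v1 : Z2) : set plane :=
  [set phi | sharp_cond phi v0 /\ sharp_cond phi v1].

Definition diamond : set plane := [set p | `|p.1| + `|p.2| <= 2^-1].

End Plane.

Arguments flux_set R L : clear implicits.
Arguments sharp R v0 v1 : clear implicits.
Arguments diamond R : clear implicits.

(* Main.v *)
Require Import Defs.
From mathcomp Require Import all_boot all_order all_algebra.
From mathcomp Require Import all_classical all_reals all_analysis.
From mathcomp Require Import zify ring lra.
Import Order.TTheory GRing.Theory Num.Theory.
Import numFieldNormedType.Exports.
Local Open Scope classical_set_scope.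
Local Open Scope ring_scope.

Set Implicit Arguments.
Unset Strict Implicit.
Unset Printing Implicit Defensive.

(* Along an oriented edge a height function h increases by 1 or by -3. From an
   even point, a diagonal step can be taken along two positively oriented edges
   or against two of them, so it changes h by exactly 2 or -2. This gives both
   the residue of h mod 4 on L, hence the condition defining L^#, and the bound
   |h(n, +-n)| <= 2|n|, which on the multiples of (1, 1) and (1, -1) in L is
   the condition defining Q.
   Conversely, given phi in L^# and Q, let f x = 4 <phi, x> + c x, where c is 0
   on even points and 4|phi_1| - 1 on odd ones. As |phi_1| + |phi_2| <= 1/2, f
   increases by an amount in [-3, 1] along oriented edges. Rounding f x down to
   the residue class mod 4 that heights have at x therefore gives increments 1
   or -3, and matching the two squares on either side of each edge with
   increment -3 is a tiling. The rounding commutes with translations by L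
   because phi is in L^#. *)

(* Elaborating [(x, y + 1)] directly makes the component type a structure
   projection, and such terms are distinct atoms for [lia]. *)
Local Notation pt x y := (@pair int int x y) (only parsing).

(** * Edges of the grid and the squares on their two sides *)

Lemma pairD (a a' b b' : int) : (a, b) + (a', b') = pt (a + a') (b + b').
Proof. by []. Qed.

(** The clockwise boundary of a black square leaves its two even corners vertically and its two odd
    corners horizontally. *)
Lemma orientedP (x y x' y' : int) :
  oriented (x, y) (x', y') <->
  if (2 %| x + y)%Z then x' = x /\ (y' = y + 1 \/ y' = y - 1)
  else y' = y /\ (x' = x + 1 \/ x' = x - 1).
Proof.
split.
  case=> -[a b]; rewrite /black /clockwise_sides !inE /= => even_ab.
  by case/or4P=> /eqP[-> -> -> ->]; case: ifP; lia.
(* In each case the witness is the square to the right of the edge, since a clockwise boundary keeps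
   its square on the right. *)
case: ifP => even_xy [-> [] ->].
- exists (x, y) => //.
  by rewrite !inE !pairD !addr0 eqxx.
- exists (x - 1, y - 1); first by rewrite /black /=; lia.
  by rewrite !inE !pairD !addr0 !subrK eqxx !orbT.
- exists (x, y - 1); first by rewrite /black /=; lia.
  by rewrite !inE !pairD !addr0 !subrK eqxx !orbT.
- exists (x - 1, y); first by rewrite /black /=; lia.
  by rewrite !inE !pairD !addr0 !subrK eqxx !orbT.
Qed.

(** Listed in the order of [clockwise_sides], so that zipping the two lists attaches to each
    neighbour the side it shares with [s]. *)
Definition neighbours (s : int * int) : seq (int * int) :=
  [:: s + (-1, 0); s + (0, 1); s + (1, 0); s + (0, -1)].

Lemma common_sideP (s s' u w : int * int) :
  common_side s s' u w <->
  (s', (u, w)) \in zip (neighbours s) (clockwise_sides s) \/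
  (s', (w, u)) \in zip (neighbours s) (clockwise_sides s).
Proof.
case: s s' u w => [x y] [x' y'] [a b] [c d].
rewrite /common_side /side /neighbours /clockwise_sides /= !inE !pairD !addr0.
split=> [[neq]|].
  have {neq} neq : (x != x') || (y != y').
    rewrite -negb_and; apply/andP=> -[/eqP xx' /eqP yy'].
    by apply: neq; congr pair.
  rewrite !xpair_eqE.
  by case=> /or4P[] /andP[/andP[/eqP-> /eqP->] /andP[/eqP-> /eqP->]]; lia.
case=> /or4P[] /eqP[-> -> -> -> -> ->]; split; try by case; lia.
all: rewrite ?subrK ?subr_eq ?eqxx ?orbT ?addrK; auto.
Qed.

(** * Height increments and the matching of squares they determine *)

Definition steps (h : int * int -> int) : Prop :=
  forall u w, oriented u w -> h w = h u + 1 \/ h w = h u - 3.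

(* [a], [b], [c], [d] are the heights at the corners of a unit square, clockwise
   from its lower-left corner. *)
Definition steps_around (even : bool) (a b c d : int) : Prop :=
  even /\ (b = a + 1 \/ b = a - 3) /\ (c = b + 1 \/ c = b - 3) /\
    (d = c + 1 \/ d = c - 3) /\ (a = d + 1 \/ a = d - 3) \/
  ~ even /\ (a = b + 1 \/ a = b - 3) /\ (b = c + 1 \/ b = c - 3) /\
    (c = d + 1 \/ c = d - 3) /\ (d = a + 1 \/ d = a - 3).

Lemma steps_corners (h : int * int -> int) (x y : int) : steps h ->
  steps_around (2 %| x + y)%Z
    (h (pt x y)) (h (pt x (y + 1))) (h (pt (x + 1) (y + 1)))
    (h (pt (x + 1) y)).
Proof.
move=> hs; case: (boolP (2 %| x + y)%Z) => [par|/negP par]; [left|right];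
  split=> //.
  by do !split; apply: hs; apply/orientedP; case: ifP; lia.
by do !split; apply: hs; apply/orientedP; case: ifP; lia.
Qed.

(** The last branch needs no test: under [steps h] exactly one side of [s] has height difference 3
    in absolute value. *)
Definition partner (h : int * int -> int) (s : int * int) : int * int :=
  if `|h (s + (0, 1)) - h s| == 3 then s + (-1, 0)
  else if `|h (s + (1, 1)) - h (s + (0, 1))| == 3 then s + (0, 1)
  else if `|h (s + (1, 0)) - h (s + (1, 1))| == 3 then s + (1, 0)
  else s + (0, -1).

(* The four oriented increments around a square sum to zero, so exactly one of
   its sides carries the increment -3. *)
Lemma partner_crossing (h : int * int -> int) (s s' u w : int * int) :
  steps h -> common_side s s' u w -> (partner h s = s' <-> `|h w - h u| = 3).
Proof.
move=> hs /common_sideP suw; have sq : steps_around (2 %| s.1 + s.2)%Z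
    (h s) (h (s + (0, 1))) (h (s + (1, 1))) (h (s + (1, 0))).
  by case: s {suw} => x y; rewrite !pairD !addr0; exact: steps_corners.
move: suw; rewrite /partner !inE !xpair_eqE; move: sq.
set a := h s; set b := h (s + (0, 1)).
set c := h (s + (1, 1)); set d := h (s + (1, 0)).
move=> sq suw.
have {sq} : `|b - a| = 3 /\ `|c - b| = 1 /\ `|d - c| = 1 /\ `|a - d| = 1 \/
  `|b - a| = 1 /\ `|c - b| = 3 /\ `|d - c| = 1 /\ `|a - d| = 1 \/
  `|b - a| = 1 /\ `|c - b| = 1 /\ `|d - c| = 3 /\ `|a - d| = 1 \/
  `|b - a| = 1 /\ `|c - b| = 1 /\ `|d - c| = 1 /\ `|a - d| = 3.
  clearbody a b c d; clear -sq.
  case: sq => -[_ [[] ? [[] ? [[] ? [] ?]]]]; solve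
    [ exfalso; lia
    | left; repeat split; lia
    | right; left; repeat split; lia
    | right; right; left; repeat split; lia
    | right; right; right; repeat split; lia].
by case=> [|[|[]]] [ab [bc [cd da]]];
  case: suw => /or4P[] /and3P[/eqP-> /eqP-> /eqP->];
  rewrite -/a -/b -/c -/d ?[`|a - b|]distrC ?[`|b - c|]distrC ?[`|c - d|]distrC
    ?[`|d - a|]distrC ?ab ?bc ?cd ?da /=; split=> [/addrI /eqP|/eqP].
Qed.

Lemma partner_side (h : int * int -> int) (s : int * int) :
  exists u w, common_side s (partner h s) u w.
Proof.
rewrite /partner; case: ifP => _; last case: ifP => _; last case: ifP => _.
- by exists s, (s + (0, 1)); apply/common_sideP; left; rewrite !inE eqxx.
- exists (s + (0, 1)), (s + (1, 1)); apply/common_sideP; left.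
  by rewrite !inE eqxx !orbT.
- exists (s + (1, 1)), (s + (1, 0)); apply/common_sideP; left.
  by rewrite !inE eqxx !orbT.
- exists (s + (1, 0)), s; apply/common_sideP; left.
  by rewrite !inE eqxx !orbT.
Qed.

Lemma common_sideC (s s' u w : int * int) :
  common_side s s' u w -> common_side s' s u w.
Proof. by case=> neq su s'u; split=> // /esym. Qed.

(** The side with difference 3 that matches [s] to its partner is also a side of the partner, and so
    matches it back to [s]. *)
Lemma partnerK (h : int * int -> int) : steps h -> involutive (partner h).
Proof.
move=> hs s; have [u [w suw]] := partner_side h s.
by apply/(partner_crossing hs (common_sideC suw))/(partner_crossing hs suw).
Qed.

(** Only height differences enter [partner], and the constant [k] cancels in them. *)
Lemma partner_shift (h : int * int -> int) (v : int * int) (k : int) :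
  (forall x, h (x + v) = h x + k) ->
  forall s, partner h (s + v) = partner h s + v.
Proof.
move=> hv s; have subK (a b : int) : a + k - (b + k) = a - b by lia.
rewrite /partner !(addrAC s v) !hv !subK.
by do ![case: ifP => // _].
Qed.

Lemma oriented_common_side (u w : int * int) :
  oriented u w -> exists s s', common_side s s' u w.
Proof.
case=> s _; rewrite !inE => uw; exists s.
case/or4P: (uw) => /eqP[-> ->]; [exists (s + (-1, 0))|exists (s + (0, 1))|
    exists (s + (1, 0))|exists (s + (0, -1))];
  by apply/common_sideP; left; rewrite !inE eqxx ?orbT.
Qed.

Lemma height_steps (R : realType) (t : set (set (R * R))) h :
  is_height t h -> steps h.
Proof.
by move=> [_ ht] u w /ht[nc c]; case: (EM (crosses t u w)) => [/c|/nc]; auto.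
Qed.

(** * Growth of heights along diagonals *)

Lemma pm2_seq (g : int -> int) :
  (forall n, g (n + 1) = g n + 2 \/ g (n + 1) = g n - 2) ->
  forall n, (4 %| g n - g 0 - 2 * n)%Z /\ `|g n - g 0| <= 2 * `|n|.
Proof.
move=> gS; elim/int_ind => [|n IH|n IH].
- by rewrite !subrr mulr0.
- have := gS n; have -> : n%:Z + 1 = n.+1 by lia.
  by lia.
- have := gS (- n.+1%:Z); have -> : - n.+1%:Z + 1 = - n%:Z by lia.
  by lia.
Qed.

(** One route around the square follows the orientation and changes [h] by 2, -2 or -6; the other
    goes against it and gives -2, 2 or 6. Only 2 and -2 are common to both. The second diagonal
    crosses the square at [(x, y - 1)]. *)
Lemma steps_diag (h : int * int -> int) (x y : int) :
  steps h -> (2 %| x + y)%Z ->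
  (h (pt (x + 1) (y + 1)) = h (pt x y) + 2 \/
   h (pt (x + 1) (y + 1)) = h (pt x y) - 2) /\
  (h (pt (x + 1) (y - 1)) = h (pt x y) + 2 \/
   h (pt (x + 1) (y - 1)) = h (pt x y) - 2).
Proof.
move=> hs even_xy.
have := steps_corners x y hs; have := steps_corners x (y - 1) hs.
have -> : y - 1 + 1 = y by lia.
by rewrite /steps_around; lia.
Qed.

(** The point [(a + b, a - b)] is reached from the origin by [b] steps (1, -1) and then [a] steps
    (1, 1), so the two congruences add up. Each bound uses one direction only. *)
Lemma steps_diagonals (h : int * int -> int) (a b : int) : steps h ->
  [/\ (4 %| h (pt (a + b) (a - b)) - h (pt 0 0) - 2 * (a + b))%Z,
      `|h (pt a a) - h (pt 0 0)| <= 2 * `|a| &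
      `|h (pt b (- b)) - h (pt 0 0)| <= 2 * `|b| ].
Proof.
move=> hs.
have up c n : h (pt (n + 1 + c) (n + 1 - c)) = h (pt (n + c) (n - c)) + 2 \/
    h (pt (n + 1 + c) (n + 1 - c)) = h (pt (n + c) (n - c)) - 2.
  have [//|+ _] := steps_diag (x := n + c) (y := n - c) hs; first by lia.
  by rewrite !(addrAC n _ 1).
have [D2 B2] : (4 %| h (pt b (- b)) - h (pt 0 0) - 2 * b)%Z /\
    `|h (pt b (- b)) - h (pt 0 0)| <= 2 * `|b|.
  apply: (@pm2_seq (fun n => h (pt n (- n)))) => n.
  have [//|_] := steps_diag (x := n) (y := - n) hs; first by lia.
  by rewrite -opprD.
have [D1 _] := @pm2_seq (fun n => h (pt (n + b) (n - b))) (up b) a.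
have [_ B1] := @pm2_seq (fun n => h (pt (n + 0) (n - 0))) (up 0) a.
move: D1 B1; cbv beta; rewrite ?addr0 ?subr0 ?add0r => D1 B1; split=> //.
by lia.
Qed.

(** * From matchings of squares to tilings of the plane *)

Section PlaneTilings.
Variable R : realType.

Lemma square_unique (s s' : int * int) (p : R * R) :
  s.1%:~R < p.1 < (s.1 + 1)%:~R -> s.2%:~R < p.2 < (s.2 + 1)%:~R ->
  square s' p -> s' = s.
Proof.
case: s s' p => [x y] [x' y'] [a b] /= /andP[xa ax] /andP[yb yb'].
move=> [/andP[x'a ax'] /andP[y'b by']].
have := le_lt_trans x'a ax; have := lt_le_trans xa ax'.
have := le_lt_trans y'b yb'; have := lt_le_trans yb by'.
by rewrite !ltr_int /= => *; congr pair; lia.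
Qed.

Definition centre (s : int * int) : R * R := (s.1%:~R + 2^-1, s.2%:~R + 2^-1).

Lemma square_centre (s s' : int * int) : square s (centre s') <-> s = s'.
Proof.
split=> [|->].
  by apply: square_unique; rewrite /= intrD mulr1z; lra.
by rewrite /square /= !intrD !mulr1z; split; lra.
Qed.

(** The centre of a square lies in no other square, so testing centres recovers the two squares from
    their union. *)
Lemma squareU_inj (s1 s1' s2 s2' : int * int) :
  s1 <> s1' -> s2 <> s2' ->
  square s1 `|` square s1' = square s2 `|` square s2' :> set (R * R) ->
  s1 = s2 /\ s1' = s2' \/ s1 = s2' /\ s1' = s2.
Proof.
move=> neq1 neq2 E.
have E12 s : s1 = s \/ s1' = s <-> s2 = s \/ s2' = s.
  have := congr1 (fun D : set (R * R) => D (centre s)) E.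
  by rewrite /setU /= => {}E; rewrite -!square_centre E.
have [] := (E12 s1).1 (or_introl erefl).
  by have [] := (E12 s1').1 (or_intror erefl); intuition congruence.
by have [] := (E12 s1').1 (or_intror erefl); intuition congruence.
Qed.

(* Moving a point of both interiors slightly up and to the right puts it in the
   interior of a single unit square. *)
Lemma interior_squareU (s1 s1' s2 s2' : int * int) (p : R * R) :
  interior (square s1 `|` square s1') p ->
  interior (square s2 `|` square s2') p ->
  exists s, (s = s1 \/ s = s1') /\ (s = s2 \/ s = s2').
Proof.
(* Floors place [p] in a square closed below and on the left, open above and on the right, so a
   small shift up and to the right lands strictly inside it. *)
case: p => p1 p2 I1 I2; pose s : int * int := (Num.floor p1, Num.floor p2).
have toR (a : R) : (a + e) @[e --> 0^'+] --> a.
  rewrite -[X in _ --> X]addr0; apply: cvgD; first exact: cvg_cst.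
  by apply: cvg_at_right_filter; exact: cvg_id.
have toP : (p1 + e, p2 + e) @[e --> 0^'+] --> (p1, p2).
  by have := @cvg_pair R R R _ _ _ _ _ _ _ _ (toR p1) (toR p2); exact.
have /andP[f1 g1] := floor_itv p1; have /andP[f2 g2] := floor_itv p2.
have [e [e0 e1 e2 D1 D2]] : exists e : R, [/\ 0 < e,
    e < (s.1 + 1)%:~R - p1, e < (s.2 + 1)%:~R - p2,
    (square s1 `|` square s1') (p1 + e, p2 + e) &
    (square s2 `|` square s2') (p1 + e, p2 + e)].
  near (0 : R)^'+ => e; exists e; split; near: e.
  - exact: nbhs_right_gt.
  - by apply: nbhs_right_lt; rewrite subr_gt0.
  - by apply: nbhs_right_lt; rewrite subr_gt0.
  - exact: (toP _ I1).
  - exact: (toP _ I2).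
have uniq s' : square s' (p1 + e, p2 + e) -> s = s'.
  move=> sq; symmetry; apply: square_unique sq => /=;
    by move: f1 f2 e1 e2 e0 => /=; lra.
exists s; split.
  by case: D1 => /uniq; auto.
by case: D2 => /uniq; auto.
Unshelve. all: by end_near. Qed.

Definition pairing (M : int * int -> int * int) : set (set (R * R)) :=
  [set D | exists s, D = square s `|` square (M s)].

(** Dominoes whose interiors meet share a unit square, and an involution puts each square in only
    one domino. *)
Lemma pairing_tiling (M : int * int -> int * int) : involutive M ->
  (forall s, exists u w, common_side s (M s) u w) -> tiling (pairing M).
Proof.
move=> MK Mside; split.
- by move=> _ [s ->]; have [u [w suw]] := Mside s; exists s, (M s), u, w.
- move=> _ _ [s1 ->] [s2 ->] [p [/interior_squareU I1 /I1]].
  move=> [s []] [] -> [] E; rewrite ?E ?MK //.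
  + by rewrite setUC.
  + by rewrite -E MK setUC.
  + by rewrite -(MK s1) E MK.
- rewrite -subTset => p _; pose s : int * int := (Num.floor p.1, Num.floor p.2).
  exists (square s `|` square (M s)); first by exists s.
  have /andP[a /ltW b] := floor_itv p.1; have /andP[c /ltW d] := floor_itv p.2.
  by left; split; apply/andP.
Qed.

Lemma square_shift (s v : int * int) :
  [set p + emb R v | p in square s] = square (s + v).
Proof.
apply/seteqP; split=> [_ [p [] + + <-]|p [] /=] => /andP[a b] /andP[c d].
  by rewrite /square /=; move: a b c d; rewrite !intrD; split; lra.
exists (p - emb R v); last by rewrite subrK.
by rewrite /square /=; move: a b c d; rewrite !intrD; split; lra.
Qed.

Lemma pairing_periodic (M : int * int -> int * int) (L : set (int * int)) :
  (forall s v, L v -> M (s + v) = M s + v) -> lattice_periodic L (pairing M).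
Proof.
move=> MS v Lv _ [s ->]; exists (s + v).
by rewrite image_setU !square_shift MS.
Qed.

Lemma pairing_crosses (h : int * int -> int) (u w : int * int) :
  steps h -> oriented u w ->
  crosses (pairing (partner h)) u w <-> `|h w - h u| = 3.
Proof.
move=> hs uw; split=> [[s [s' [suw [r E]]]]|cut].
  apply/(partner_crossing hs suw).
  have neq r' : r' <> partner h r'.
    by have [x [y []]] := partner_side h r'.
  have [neq_ss' _ _] := suw.
  by case: (squareU_inj neq_ss' (neq r) E) => [[-> ->]|[-> ->]];
    rewrite ?partnerK.
have [s [s' suw]] := oriented_common_side uw.
exists s, s'; split=> //; exists s; congr (_ `|` square _).
by apply/esym/(partner_crossing hs suw).
Qed.

Lemma pairing_height (h : int * int -> int) :
  steps h -> h 0 = 0 -> is_height (pairing (partner h)) h.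
Proof.
move=> hs h0; split=> // u w uw; have [cut_eq eq_cut] := pairing_crosses hs uw.
have step := hs u w uw; split=> [not_cut|/cut_eq]; last by lia.
by have : `|h w - h u| <> 3 by [move/eq_cut]; lia.
Qed.

End PlaneTilings.

(** * The condition defining L^# on lattice vectors *)

Section Flux.
Variable R : realType.
Implicit Types (phi : R * R) (v x : int * int).

Lemma dotD phi v x : dot phi (v + x) = dot phi v + dot phi x.
Proof. by rewrite /dot /= !intrD; ring. Qed.

Lemma pair_mulrz (v : int * int) (n : int) : v *~ n = pt (v.1 * n) (v.2 * n).
Proof.
case: v => x y; have E k : (x, y) *+ k = pt (x *+ k) (y *+ k).
  by elim: k => // k IH; rewrite !mulrS IH pairD.
by rewrite -!mulrzz; case: n => n; rewrite /intmul E.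
Qed.

Lemma dotMz phi v (n : int) : dot phi (v *~ n) = dot phi v * n%:~R.
Proof. by rewrite pair_mulrz /dot /= !intrM; ring. Qed.

(* Merges the two clauses of [sharp_cond] into one closed under addition. *)
Definition adapted phi v : Prop :=
  (2 %| v.1 - v.2)%Z /\ dot phi v - v.1%:~R / 2 \is a Num.int.

Lemma adaptedD phi v x : adapted phi v -> adapted phi x -> adapted phi (v + x).
Proof.
move=> [ev iv] [ex ix]; split.
  rewrite /= opprD addrACA; exact: rpredD.
have -> : dot phi (v + x) - (v + x).1%:~R / 2 =
  (dot phi v - v.1%:~R / 2) + (dot phi x - x.1%:~R / 2).
  by rewrite dotD /= intrD; ring.
exact: rpredD.
Qed.

Lemma adaptedMz phi v (n : int) : adapted phi v -> adapted phi (v *~ n).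
Proof.
move=> [ev iv]; split; rewrite ?dotMz pair_mulrz /=.
  by rewrite -mulrBl dvdz_mulr.
have -> : dot phi v * n%:~R - (v.1 * n)%:~R / 2 =
  (dot phi v - v.1%:~R / 2) * n%:~R by rewrite intrM; ring.
by rewrite rpredM ?rpred_int.
Qed.

(** Half of [v.1] is an integer on [scrE] and a half-integer on [scrO]. The parity of [v.1]
    separates the two classes, so the clause for the other class is vacuous. *)
Lemma sharp_condP phi v :
  (scrE `|` scrO) v -> sharp_cond phi v <-> adapted phi v.
Proof.
case=> -[w E]; rewrite /adapted.
  have -> : dot phi v - v.1%:~R / 2 = dot phi v - w.1%:~R.
    by rewrite E mulr2n /= intrD; field.
  rewrite [_ - w.1%:~R \is a _]rpredBr ?rpred_int //.
  split=> [[/(_ (ex_intro _ w E)) ? _]|[_ ?]].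
    by split=> //; rewrite E mulr2n /=; lia.
  by split=> // -[x Ex]; have := congr1 fst E; rewrite Ex !mulr2n /=; lia.
have -> : dot phi v - v.1%:~R / 2 = dot phi v - 2^-1 - w.1%:~R.
  by rewrite E mulr2n /= !intrD; field.
rewrite [_ - w.1%:~R \is a _]rpredBr ?rpred_int //.
split=> [[_ /(_ (ex_intro _ w E)) ?]|[_ ?]].
  by split=> //; rewrite E mulr2n /=; lia.
by split=> // -[x Ex]; have := congr1 fst E; rewrite Ex !mulr2n /=; lia.
Qed.

Lemma adapted_lattice phi v0 v1 v :
  adapted phi v0 -> adapted phi v1 -> lattice v0 v1 v -> adapted phi v.
Proof.
move=> ad0 ad1 [a [b ->]]; apply: adaptedD; exact: adaptedMz.
Qed.

(** * Every point of L^# in Q is a flux: rounding a ramp *)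

(* The residues mod 4 of all height functions. *)
Definition level (x : int * int) : int :=
  if (2 %| x.1)%Z then if (2 %| x.2)%Z then 0 else 1
  else if (2 %| x.2)%Z then 3 else 2.

Definition ramp phi (x : int * int) : R :=
  4 * dot phi x + (if (2 %| x.1 + x.2)%Z then 0 else 4 * `|phi.1| - 1).

Definition ramp_height phi (x : int * int) : int :=
  level x + 4 * Num.floor ((ramp phi x - (level x)%:~R) / 4).

Lemma ramp_heightP phi x : (4 %| ramp_height phi x - level x)%Z /\
  (ramp_height phi x)%:~R <= ramp phi x < (ramp_height phi x)%:~R + 4.
Proof.
rewrite /ramp_height; split; first by lia.
have := floor_itv ((ramp phi x - (level x)%:~R) / 4).
by rewrite !intrD intrM; lra.
Qed.

(** A half-open interval of length 4 contains exactly one integer of each residue class mod 4. *)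
Lemma ramp_height_eq phi x (n : int) : (4 %| n - level x)%Z ->
  n%:~R <= ramp phi x < n%:~R + 4 -> ramp_height phi x = n.
Proof.
have [m4 /andP[m_le lt_m]] := ramp_heightP phi x.
move=> n4 /andP[n_le lt_n].
have : (ramp_height phi x)%:~R < (n + 4)%:~R :> R by rewrite intrD; lra.
have : n%:~R < (ramp_height phi x + 4)%:~R :> R by rewrite intrD; lra.
by rewrite !ltr_int; lia.
Qed.

(** With [phi] = (p, q), vertical edges leave even points and give ±4q + 4|p| - 1; horizontal edges
    leave odd points and give ±4p - 4|p| + 1. *)
Lemma ramp_step phi u w : diamond R phi -> oriented u w ->
  - 3 <= ramp phi w - ramp phi u <= 1.
Proof.
case: phi u w => p q [x y] [x' y'] pq_le /orientedP uw.
have {}pq_le : `|p| + `|q| <= 2^-1 := pq_le.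
have p1 : p <= `|p| by exact: ler_norm.
have p2 : - p <= `|p| by rewrite -normrN; exact: ler_norm.
have q1 : q <= `|q| by exact: ler_norm.
have q2 : - q <= `|q| by rewrite -normrN; exact: ler_norm.
rewrite /ramp /dot /=; move: pq_le p1 p2 q1 q2.
move: `|p| `|q| => a b pq_le p1 p2 q1 q2; move: uw.
case: ifP => even [-> [] ->].
- have -> : (2 %| x + (y + 1))%Z = false by lia.
  by rewrite intrD; lra.
- have -> : (2 %| x + (y - 1))%Z = false by lia.
  by rewrite intrD; lra.
- have -> : (2 %| x + 1 + y)%Z by lia.
  by rewrite intrD; lra.
- have -> : (2 %| x - 1 + y)%Z by lia.
  by rewrite intrD; lra.
Qed.

(** Rounding errors lie in [0, 4), so an increment lies strictly between -7 and 5. Being 1 mod 4, it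
    is -3 or 1. *)
Lemma ramp_height_steps phi : diamond R phi -> steps (ramp_height phi).
Proof.
move=> dphi u w uw; have /andP[lo hi] := ramp_step dphi uw.
have [a4 /andP[a_le lt_a]] := ramp_heightP phi u.
have [b4 /andP[b_le lt_b]] := ramp_heightP phi w.
have lt1 : (ramp_height phi w)%:~R < (ramp_height phi u + 5)%:~R :> R.
  by rewrite intrD; lra.
have lt2 : (ramp_height phi u)%:~R < (ramp_height phi w + 7)%:~R :> R.
  by rewrite intrD; lra.
have : (4 %| level w - level u - 1)%Z.
  case: u w uw {lo hi a4 a_le lt_a b4 b_le lt_b lt1 lt2}.
  move=> x y [x' y'] /orientedP.
  by rewrite /level /=; case: ifP => ? [-> [] ->]; do ?case: ifP; lia.
by move: lt1 lt2; rewrite !ltr_int; lia.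
Qed.

Lemma ramp_height0 phi : ramp_height phi 0 = 0.
Proof.
have ramp0 : ramp phi 0 = 0 by rewrite /ramp /dot /= !mulr0 !addr0 mulr0.
by apply: ramp_height_eq => //; rewrite ramp0 mulr0z lexx add0r ltr0n.
Qed.

(** Translation by [v] adds 4<phi, v> to the ramp. This is an integer congruent to 2 [v.1] mod 4,
    which is also the change of [level], so rounding commutes with the translation. *)
Lemma ramp_height_shift phi v : adapted phi v -> exists2 k : int,
  4 * dot phi v = k%:~R &
  forall x, ramp_height phi (x + v) = ramp_height phi x + k.
Proof.
move=> [ev /intrP[j Ej]]; have Ek : 4 * dot phi v = (2 * v.1 + 4 * j)%:~R.
  by rewrite intrD !intrM -Ej; field.
exists (2 * v.1 + 4 * j) => // x.
have [m4 /andP[m_le lt_m]] := ramp_heightP phi x.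
have Er : ramp phi (x + v) = ramp phi x + (2 * v.1 + 4 * j)%:~R.
  rewrite /ramp dotD -Ek /=.
  have -> : (2 %| x.1 + v.1 + (x.2 + v.2))%Z = (2 %| x.1 + x.2)%Z by lia.
  by rewrite mulrDr addrAC.
apply: ramp_height_eq; last by rewrite Er intrD; lra.
suff : (4 %| level (x + v) - level x - 2 * v.1)%Z by lia.
by rewrite /level /=; do ?case: ifP; lia.
Qed.

Lemma sharp_diamond_flux v0 v1 phi : valid_basis v0 v1 ->
  sharp R v0 v1 phi -> diamond R phi -> flux_set R (lattice v0 v1) phi.
Proof.
move=> [par0 par1 _] [/(sharp_condP _ par0) ad0 /(sharp_condP _ par1) ad1] dphi.
have hs := ramp_height_steps dphi.
have shift v (Lv : lattice v0 v1 v) :=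
  ramp_height_shift (adapted_lattice ad0 ad1 Lv).
exists (pairing (partner (ramp_height phi))), (ramp_height phi); split.
- by apply: pairing_tiling; [exact: partnerK|exact: partner_side].
- apply: pairing_periodic => s v /shift[k _ hk]; exact: partner_shift hk s.
- apply: pairing_height => //; exact: ramp_height0.
- by move=> v /shift[k -> hk] u; rewrite hk addrC addKr.
Qed.

(** * Every flux lies in L^# and in Q *)

Lemma flux_adapted h phi v : steps h -> h 0 = 0 ->
  (scrE `|` scrO) v -> 4 * dot phi v = (h v)%:~R -> adapted phi v.
Proof.
move=> hs h0 par Eh.
have ev : (2 %| v.1 - v.2)%Z by case: par => -[w ->]; rewrite mulr2n /=; lia.
split=> //; case: v {par} ev Eh => x y /= ev Eh.
(* These divisions are exact since x - y is even. They write [v] as [(a + b, a - b)], where heights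
   are 2x mod 4. *)
pose a := ((x + y) %/ 2)%Z; pose b := ((x - y) %/ 2)%Z.
have [+ _ _] := steps_diagonals a b hs.
have -> : a + b = x by lia.
have -> : a - b = y by lia.
rewrite -[pt 0 0]/(0 : int * int) h0 subr0 => /dvdzP[j Ej].
apply/intrP; exists j; have := congr1 (intmul (1 : R)) Ej.
by rewrite /= intrB !intrM -Eh; lra.
Qed.

Lemma lattice_diagonal v0 v1 : lin_indep v0 v1 -> exists2 n : int, n != 0 &
  lattice v0 v1 (pt n n) /\ lattice v0 v1 (pt n (- n)).
Proof.
case: v0 v1 => a b [c d] free.
(* By Cramer's rule, the lattice contains every integer vector multiplied by the determinant. *)
exists (a * d - b * c).
  apply/eqP => det0.
  (* With zero determinant, d v0 - b v1 = 0 and c v0 - a v1 = 0, so independence makes all entries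
     vanish; this is absurd. *)
  have [d0 b0] : d = 0 /\ - b = 0.
    by apply: free; rewrite !pair_mulrz pairD /=; congr pair; lia.
  have [c0 a0] : c = 0 /\ - a = 0.
    by apply: free; rewrite !pair_mulrz pairD /=; congr pair; lia.
  have [] // : 1 = 0 :> int /\ 0 = 0 :> int.
  by apply: free; rewrite !pair_mulrz pairD /=; congr pair; lia.
split; [exists (d - c), (a - b)|exists (d + c), (- (a + b))];
  by rewrite !pair_mulrz pairD /=; congr pair; ring.
Qed.

(** |p| + |q| is the larger of |p + q| and |p - q|. Each is at most 1/2, because h(n, ±n) = 4n(p ±
    q) is bounded by 2|n| and n is nonzero. *)
Lemma flux_diamond h phi v0 v1 : steps h -> h 0 = 0 -> lin_indep v0 v1 ->
  is_flux (lattice v0 v1) h phi -> diamond R phi.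
Proof.
move=> hs h0 free fl; have [n n0 [L1 L2]] := lattice_diagonal free.
have [_ up down] := steps_diagonals n n hs.
have := fl _ L1 0; have := fl _ L2 0; rewrite !add0r h0 !subr0 => E2 E1.
have {}up : `|(h (pt n n))%:~R : R| <= 2 * `|n%:~R|.
  by move: up; rewrite h0 subr0 -(ler_int R) intrM !intr_norm.
have {}down : `|(h (pt n (- n)))%:~R : R| <= 2 * `|n%:~R|.
  by move: down; rewrite h0 subr0 -(ler_int R) intrM !intr_norm.
have n1 : 0 < `|n%:~R : R| by rewrite normr_gt0 intr_eq0.
have {}up : `|phi.1 + phi.2| <= 2^-1.
  rewrite -(ler_pM2l n1) -normrM; move: up.
  have -> : (h (pt n n))%:~R = 4 * (n%:~R * (phi.1 + phi.2)).
    by rewrite -E1 /dot /=; ring.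
  by rewrite [`|4 * _|]normrM ger0_norm //; lra.
have {}down : `|phi.1 - phi.2| <= 2^-1.
  rewrite -(ler_pM2l n1) -normrM; move: down.
  have -> : (h (pt n (- n)))%:~R = 4 * (n%:~R * (phi.1 - phi.2)).
    by rewrite -E2 /dot /= intrN; ring.
  by rewrite [`|4 * _|]normrM ger0_norm //; lra.
move: up down; rewrite /diamond /= !ler_norml => /andP[? ?] /andP[? ?].
by case: (ler0P phi.1) => ?; case: (ler0P phi.2) => ?; lra.
Qed.

End Flux.

Theorem theorem1 (R : realType) (v0 v1 : int * int)
    (hv : valid_basis v0 v1) :
  flux_set R (lattice v0 v1) = sharp R v0 v1 `&` diamond R.
Proof.
apply/seteqP; split=> [phi [t [h [_ _ ht fl]]]|phi [sh di]]; last first.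
  exact: sharp_diamond_flux.
have [par0 par1 free] := hv; have hs := height_steps ht; have h0 := ht.1.
split; last exact: flux_diamond free fl.
split; apply/sharp_condP => //; apply: (flux_adapted hs h0) => //.
  have L0 : lattice v0 v1 v0 by exists 1, 0; rewrite mulr1z mulr0z addr0.
  by rewrite (fl v0 L0 0) add0r h0 subr0.
have L1 : lattice v0 v1 v1 by exists 0, 1; rewrite mulr1z mulr0z add0r.
by rewrite (fl v1 L1 0) add0r h0 subr0.
Qed.
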